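(* There is a group $G$ of cardinality continuum such that $\psi(G,\mathfrak Z_{G^2[x]})=\aleph_0$. In fact, the group $G$ contains two disjoint countable subsets $A,B\subset G$ such that $\{1\}=\bigcap_{w\in W}\mathfrak Z_w$, where $W=\{xax^{-1}b^{-1}: a\in A,\ b\in B\}\subset G[x]$.
   Context: Let $G$ be a group with neutral element $1$, and let $G[x]=G*\langle x\rangle$ be the free product of $G$ and the infinite cyclic group generated by an element $x\notin G$. Put $G^0[x]=G$ and $G^{n+1}[x]=G^n[x]\cup\{w\,x\,a,\ w\,x^{-1}a : w\in G^n[x],\ a\in G\}$ for $n\in\{0,1,2,\dots\}$. Each $w\in G[x]$ defines a map $G\to G$, $g\mapsto w(g)$, where $w(g)$ is the image of $w$ under the homomorphism $G[x]\to G$ that is the identity on $G$ and sends $x$ to $g$. The co-zero set of $w$ is $\mathfrak Z_w=\{g\in G: w(g)\ne 1\}$. For $W\subset G[x]$, $\mathfrak Z_W$ denotes the topology on $G$ generated by the sub-base $\{\mathfrak Z_w: w\in W\}$. The topology $\mathfrak Z_{G^n[x]}$ is called the $n$-th Zariski topology on $G$; it is $T_1$ for $n\ge1$. For a $T_1$-space $X$ and $p\in X$, the pseudocharacter $\psi_p(X)$ at $p$ is the smallest cardinality of a family $\mathcal U_p$ of neighborhoods of $p$ with $\bigcap\mathcal U_p=\{p\}$; the pseudocharacter of $X$ is $\psi(X)=\sup_{p\in X}\psi_p(X)$. *)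

(* Defs.v *)
From HB Require Import structures.
From mathcomp Require Import all_boot finmap all_classical.
From mathcomp Require Import topology.

Set Implicit Arguments.
Unset Strict Implicit.
Unset Printing Implicit Defensive.

Local Open Scope group_scope.
Local Open Scope classical_set_scope.
Local Open Scope card_scope.

Section FreeProduct.
Variable G : groupType.

(* Letters of the free product G * <x>: [inl a] is a \in G, [inr true] is x
   and [inr false] is x^-1. *)
Definition word := seq (G + bool)%type.

(* The congruence of the free monoid of words presenting the group G * <x>. *)
Inductive word_eq : word -> word -> Prop :=
| word_eq_refl u : word_eq u u
| word_eq_sym u v : word_eq u v -> word_eq v u
| word_eq_trans u v w : word_eq u v -> word_eq v w -> word_eq u w
| word_eq_cat u u' v v' :
    word_eq u u' -> word_eq v v' -> word_eq (u ++ v) (u' ++ v')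
| word_eq_one : word_eq [:: inl 1] [::]
| word_eq_mul a b : word_eq [:: inl a; inl b] [:: inl (a * b)]
| word_eq_inv e : word_eq [:: inr e; inr (~~ e)] [::].

Definition word_eqb (u v : word) : bool := `[< word_eq u v >].

Lemma word_eqb_refl : reflexive word_eqb.
Proof. by move=> u; apply/asboolP; exact: word_eq_refl. Qed.

Lemma word_eqb_sym : symmetric word_eqb.
Proof. by move=> u v; apply/asboolP/asboolP; exact: word_eq_sym. Qed.

Lemma word_eqb_trans : transitive word_eqb.
Proof.
move=> v u w /asboolP uv /asboolP vw; apply/asboolP.
exact: word_eq_trans uv vw.
Qed.

Canonical word_equiv := EquivRel word_eqb word_eqb_refl word_eqb_sym
  word_eqb_trans.

(* G[x] = G * <x> *)
Definition adjoin := {eq_quot word_equiv}%qT.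

HB.instance Definition _ := Choice.on adjoin.

Definition adj_class (u : word) : adjoin := (\pi_adjoin u)%qT.

Lemma adj_classP u v : adj_class u = adj_class v <-> word_eq u v.
Proof.
split=> [/eqmodP e|e]; first by move/asboolP: e.
by apply/eqmodP; apply/asboolP.
Qed.

Lemma adj_classK w : adj_class (repr w) = w.
Proof. exact: reprK. Qed.

Lemma repr_adj_class u : word_eq (repr (adj_class u)) u.
Proof. by apply/adj_classP; rewrite adj_classK. Qed.

Definition inv_letter (l : G + bool) : G + bool :=
  match l with inl a => inl a^-1 | inr e => inr (~~ e) end.

Definition inv_word (u : word) : word := rev (map inv_letter u).

Definition adj_one : adjoin := adj_class [::].
Definition adj_mul (v w : adjoin) : adjoin := adj_class (repr v ++ repr w).
Definition adj_inv (w : adjoin) : adjoin := adj_class (inv_word (repr w)).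

Lemma adj_mulE u v : adj_mul (adj_class u) (adj_class v) = adj_class (u ++ v).
Proof. by apply/adj_classP; apply: word_eq_cat; exact: repr_adj_class. Qed.

Lemma inv_letterK : involutive inv_letter.
Proof. by case=> [a|e] /=; rewrite ?invgK ?negbK. Qed.

Lemma inv_wordK : involutive inv_word.
Proof.
by move=> u; rewrite /inv_word map_rev revK -map_comp map_id_in // => l _;
  exact: inv_letterK.
Qed.

Lemma word_eq_letterV l : word_eq [:: l; inv_letter l] [::].
Proof.
case: l => [a|e] /=; last exact: word_eq_inv.
by apply: word_eq_trans (word_eq_mul _ _) _; rewrite mulgV; exact: word_eq_one.
Qed.

Lemma word_eqV u : word_eq (u ++ inv_word u) [::].
Proof.
elim: u => [|l u ih]; first exact: word_eq_refl.
rewrite /inv_word /= rev_cons -cats1 -cat_cons catA -/(inv_word u).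
apply: word_eq_trans (word_eq_letterV l).
rewrite -[[:: l; _]]/([:: l] ++ [:: inv_letter l]).
apply: word_eq_cat; last exact: word_eq_refl.
rewrite cat_cons -cat1s -[X in word_eq _ X]cats0.
by apply: word_eq_cat ih; exact: word_eq_refl.
Qed.

Lemma adj_mulA : associative adj_mul.
Proof.
move=> u v w; rewrite -(adj_classK u) -(adj_classK v) -(adj_classK w).
by rewrite !adj_mulE catA.
Qed.

Lemma adj_mul1 : left_id adj_one adj_mul.
Proof. by move=> u; rewrite -(adj_classK u) adj_mulE. Qed.

Lemma adj_mulr1 : right_id adj_one adj_mul.
Proof. by move=> u; rewrite -(adj_classK u) adj_mulE cats0. Qed.

Lemma adj_mulrV : right_inverse adj_one adj_inv adj_mul.
Proof.
move=> u; rewrite -{1}(adj_classK u) adj_mulE.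
by apply/adj_classP; exact: word_eqV.
Qed.

Lemma adj_mulV : left_inverse adj_one adj_inv adj_mul.
Proof.
move=> u; rewrite -{2}(adj_classK u) adj_mulE.
apply/adj_classP; rewrite -{2}(inv_wordK (repr u)); exact: word_eqV.
Qed.

HB.instance Definition _ := isGroup.Build adjoin
  adj_mulA adj_mul1 adj_mulr1 adj_mulV adj_mulrV.

Definition adj_const (a : G) : adjoin := adj_class [:: inl a].
Definition adj_var : adjoin := adj_class [:: inr true].

Section Lift.
Variables (H : groupType) (f : G -> H) (h : H).

Definition lift_letter (l : G + bool) : H :=
  match l with inl a => f a | inr e => if e then h else h^-1 end.

Definition lift_word (u : word) : H :=
  foldr (fun l acc => lift_letter l * acc) 1 u.

(* The homomorphism G[x] -> H extending f and sending x to h (for f a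
   homomorphism; see [adj_liftM], [adj_lift_const], [adj_lift_var] and
   [adj_lift_uniq]). *)
Definition adj_lift (w : adjoin) : H := lift_word (repr w).

Lemma lift_word_cat u v : lift_word (u ++ v) = lift_word u * lift_word v.
Proof. by elim: u => [|l u ih] /=; rewrite ?mul1g // ih mulgA. Qed.

Hypothesis fM : monoid_morphism f.

Lemma lift_word_eq u v : word_eq u v -> lift_word u = lift_word v.
Proof.
elim=> //= [? ? ? _ -> _ -> //|? ? ? ? _ e1 _ e2||a b|[]] /=.
- by rewrite !lift_word_cat e1 e2.
- by rewrite fM.1 mulg1.
- by rewrite fM.2 !mulg1.
- by rewrite mulg1 mulgV.
- by rewrite mulg1 mulVg.
Qed.

Lemma adj_lift_class u : adj_lift (adj_class u) = lift_word u.
Proof. by apply: lift_word_eq; exact: repr_adj_class. Qed.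

Lemma adj_liftM : monoid_morphism adj_lift.
Proof.
split=> [|v w]; first exact: adj_lift_class.
by rewrite [in LHS]/mul /= adj_lift_class lift_word_cat.
Qed.

Lemma adj_lift_const a : adj_lift (adj_const a) = f a.
Proof. by rewrite adj_lift_class /= mulg1. Qed.

Lemma adj_lift_var : adj_lift adj_var = h.
Proof. by rewrite adj_lift_class /= mulg1. Qed.

Lemma adj_lift_uniq (k : adjoin -> H) : monoid_morphism k ->
  (forall a, k (adj_const a) = f a) -> k adj_var = h -> k =1 adj_lift.
Proof.
move=> [k1 kM] kG kx w; rewrite -(adj_classK w) adj_lift_class.
elim: (repr w) => [|l u ih] /=; first exact: k1.
rewrite -cat1s -adj_mulE kM ih; congr (_ * _).
case: l => [a|[]] /=; [exact: kG|exact: kx|].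
apply: (@mulIg _ h); rewrite mulVg -{1}kx -kM -k1; congr k.
by rewrite [LHS]adj_mulE; apply/adj_classP; exact: word_eq_inv.
Qed.

End Lift.

(* w(g) *)
Definition adj_eval (w : adjoin) (g : G) : G := adj_lift idfun g w.

(* G^n[x] *)
Fixpoint adj_le (n : nat) : set adjoin :=
  match n with
  | 0 => range adj_const
  | n.+1 => adj_le n `|`
      [set v | exists w a, adj_le n w /\
        (v = w * adj_var * adj_const a \/ v = w * adj_var^-1 * adj_const a)]
  end.

Definition co_zero (w : adjoin) : set G := [set g | adj_eval w g != 1].

(* G endowed with the topology generated by the sub-base of the co-zero sets
   of the elements of W. *)
Definition zariski (W : set adjoin) : Type := G.

HB.instance Definition _ (W : set adjoin) := Choice.on (zariski W).
HB.instance Definition _ (W : set adjoin) :=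
  isSubBaseTopological.Build (zariski W) (co_zero @` W) id.

End FreeProduct.

Arguments adj_var {G}.

(* T1 holds for n >= 1, as needed for the pseudocharacter below to make
   sense. *)
Lemma zariski_accessible (G : groupType) n :
  accessible_space (zariski (@adj_le G n.+1)).
Proof.
have idM : monoid_morphism (@idfun G) by [].
have W a : adj_le n.+1 (adj_var * adj_const a).
  elim: n => [|n ih]; last by left.
  right; exists 1, a; split; last by left; rewrite mul1g.
  by exists 1 => //; apply/adj_classP; exact: word_eq_one.
move=> y z /eqP yz; pose U := co_zero (adj_var * adj_const (z : G)^-1).
have UE (g : G) : U g <-> g * (z : G)^-1 != 1.
  rewrite /U /co_zero /= /adj_eval (adj_liftM _ idM).2.
  by rewrite adj_lift_var // adj_lift_const.
exists U; split.
- exists [set U]; last by rewrite bigcup_set1.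
  move=> _ ->; exists [fset U]%fset; last by rewrite set_fset1 bigcap_set1.
  by move=> V /fset1P ->; rewrite inE; exists (adj_var * adj_const (z : G)^-1).
- apply/mem_set/UE/eqP => yz1; apply: yz.
  by rewrite -[LHS](@mulgVK G z y) yz1 mul1g.
- by apply/mem_set => /UE; rewrite mulgV eqxx.
Qed.

Definition pseudobase (X : topologicalType) (p : X) (U : set (set X)) : Prop :=
  U `<=` nbhs p /\ \bigcap_(V in U) V = [set p].

(* Cardinals are represented by sets (in any type) and compared by [#=] and
   [#<=]: [pseudocharacter_at p K] means psi_p(X) = |K|. *)
Definition pseudocharacter_at (X : topologicalType) (p : X) (T : Type)
    (K : set T) : Prop :=
  (exists2 U, pseudobase p U & U #= K) /\
  (forall U, pseudobase p U -> K #<= U).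

(* psi(X) = |K|: the set K is a least upper bound of the psi_p(X). *)
Definition pseudocharacter (X : topologicalType) (T : Type) (K : set T) : Prop :=
  (forall p (S : Type) (L : set S),
     @pseudocharacter_at X p S L -> L #<= K) /\
  (forall (S : Type) (M : set S),
     (forall p (S' : Type) (L : set S'),
        @pseudocharacter_at X p S' L -> L #<= M) -> K #<= M).

(* Main.v *)
(* In the group of all sequences in S_3, a word evaluated at g has an n-th entry
   depending only on g n, so the Zariski topologies are coarser than the product
   topology; hence no point is isolated and every pseudobase is infinite.
   If s and c are non-conjugate generators of S_3, no u <> 1 conjugates {s, c}
   into itself, since the center is trivial. So with A the sequences having one
   entry in {s, c} and all others 1, and B those having one entry outside {s, c},
   every g <> 1 conjugates some element of A to an element of B. *)
Require Import Defs.
From HB Require Import structures.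
From mathcomp Require Import finmap fingroup all_boot perm all_classical.
From mathcomp Require Import topology.

Local Open Scope group_scope.
Local Open Scope classical_set_scope.
Local Open Scope card_scope.

(** * Evaluation of words and countable pseudobases *)

Section ZariskiEval.
Variable G : groupType.
Implicit Types (a b g p : G) (v w : adjoin G).

Lemma idfun_monoid_morphism : monoid_morphism (@idfun G).
Proof. by []. Qed.

Lemma adj_evalM v w g : adj_eval (v * w) g = adj_eval v g * adj_eval w g.
Proof. exact: (adj_liftM g idfun_monoid_morphism).2. Qed.

Lemma adj_eval_const a g : adj_eval (adj_const a) g = a.
Proof. exact: adj_lift_const idfun_monoid_morphism a. Qed.

Lemma adj_eval_var g : adj_eval adj_var g = g.
Proof. exact: adj_lift_var idfun_monoid_morphism. Qed.

Lemma adj_evalV w g : adj_eval w^-1 g = (adj_eval w g)^-1.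
Proof.
apply: (@mulgI _ (adj_eval w g)); rewrite -adj_evalM !mulgV.
exact: (adj_liftM g idfun_monoid_morphism).1.
Qed.

Definition adj_conj a b : adjoin G :=
  adj_var * adj_const a * adj_var^-1 * adj_const b^-1.

Lemma adj_conj_le2 a b : adj_le 2 (adj_conj a b).
Proof.
right; exists (adj_var * adj_const a), b^-1; split; last by right.
right; exists 1, a; split; last by left; rewrite mul1g.
by exists 1 => //; apply/adj_classP; exact: word_eq_one.
Qed.

Lemma co_zero_conj a b g : co_zero (adj_conj a b) g <-> g * a * g^-1 <> b.
Proof.
rewrite /co_zero /adj_conj /= !(adj_evalM, adj_evalV, adj_eval_const, adj_eval_var).
rewrite -(inj_eq (@mulIg _ b)) mulgVK mul1g.
by split=> /eqP.
Qed.

Lemma co_zero_open (W : set (adjoin G)) w : W w ->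
  open (co_zero w : set (zariski W)).
Proof.
move=> Ww; exists [set co_zero w]; last by rewrite bigcup_set1.
move=> _ ->; exists [fset co_zero w]%fset; last by rewrite set_fset1 bigcap_set1.
by move=> V /fset1P ->; rewrite inE; exists w.
Qed.

(** Translating the family at 1 to [p] keeps it inside [adj_le 2]: only the constants of the words
    change. *)
Lemma countable_zariski_pseudobase (A B : set G) :
    countable A -> countable B ->
    [set 1] = \bigcap_(w in [set adj_conj a b | a in A & b in B]) co_zero w ->
  forall p : zariski (@adj_le G 2), exists2 U, pseudobase p U & countable U.
Proof.
move=> cA cB AB1 p.
(* Conjugating p^-1 a p by g is conjugating a by g p^-1, so the condition on g is the hypothesis
   read at g p^-1. *)
pose U : set (set (zariski (@adj_le G 2))) :=
  [set co_zero (adj_conj ((p : G)^-1 * a * (p : G)) b) | a in A & b in B].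
have UP g : (\bigcap_(V in U) V) g <-> g = p.
  have -> : (g = p) <-> [set 1] (g * (p : G)^-1).
    split=> [->|/= e]; first by rewrite /= mulgV.
    by rewrite -[g](@mulgVK _ (p : G)) e mul1g.
  rewrite AB1; split=> [Ug _ [a Aa [b Bb <-]]|Ug _ [a Aa [b Bb <-]]].
    have /Ug/co_zero_conj : U (co_zero (adj_conj ((p : G)^-1 * a * (p : G)) b)).
      by exists a => //; exists b.
    by move=> h; apply/co_zero_conj; rewrite invgM invgK !mulgA in h *.
  have /Ug/co_zero_conj : [set adj_conj a b | a in A & b in B] (adj_conj a b).
    by exists a => //; exists b.
  by move=> h; apply/co_zero_conj; rewrite invgM invgK !mulgA in h *.
exists U.
  split; last by apply/seteqP; split=> g /UP.
  move=> V UV; apply: open_nbhs_nbhs; split; last exact: ((UP p).2 erefl).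
  by case: UV => a _ [b _ <-]; apply: co_zero_open; exact: adj_conj_le2.
have -> : U = (fun ab => co_zero (adj_conj ((p : G)^-1 * ab.1 * (p : G)) ab.2))
              @` (A `*` B).
  apply/seteqP; split=> [_ [a Aa [b Bb <-]]|_ [[a b] [Aa Bb] <-]].
    by exists (a, b).
  by exists a => //; exists b.
apply: card_le_trans (card_image_le _ _) _; exact: countableX.
Qed.

End ZariskiEval.

(** The point [p] attains the supremum: its pseudocharacter is exactly aleph_0. On an empty space
    the supremum would be 0. *)
Lemma pseudocharacter_nat (X : topologicalType) (p : X) :
    (forall q : X, exists2 U, pseudobase q U & countable U) ->
    (forall U, pseudobase p U -> infinite_set U) ->
  pseudocharacter X [set: nat].
Proof.
move=> cX infX; split=> [q S L [_ minL]|S M ubM].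
  have [U qU cU] := cX q.
  exact: card_le_trans (minL _ qU) cU.
apply: ubM (p) _ _ _; split=> [|U /infX /infiniteP //].
have [U pU cU] := cX p.
exists U => //; rewrite card_eq_le; apply/andP; split=> //.
by apply/infiniteP; exact: infX.
Qed.

(** * Powers of a group with pointwise operations *)

Section PowerGroup.
Variables (I : Type) (F : groupType).

Definition power : Type := I -> F.

HB.instance Definition _ := Choice.on power.

Implicit Types f g h : power.

Let one : power := fun=> 1.
Let inv f : power := fun i => (f i)^-1.
Let mul f g : power := fun i => f i * g i.

Let mulA : associative mul.
Proof. by move=> f g h; apply/funext => i; exact: mulgA. Qed.

Let mul1 : left_id one mul.
Proof. by move=> f; apply/funext => i; exact: mul1g. Qed.

Let mulr1 : right_id one mul.
Proof. by move=> f; apply/funext => i; exact: mulg1. Qed.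

Let mulV : left_inverse one inv mul.
Proof. by move=> f; apply/funext => i; exact: mulVg. Qed.

Let mulrV : right_inverse one inv mul.
Proof. by move=> f; apply/funext => i; exact: mulgV. Qed.

HB.instance Definition _ := isGroup.Build power mulA mul1 mulr1 mulV mulrV.

Lemma powerME f g i : (f * g) i = f i * g i. Proof. by []. Qed.
Lemma powerVE f i : f^-1 i = (f i)^-1. Proof. by []. Qed.

(** Projection to the [i]-th factor is a homomorphism, so this entry of w(g) is a product of [i]-th
    entries of constants and of powers of [g i]. *)
Lemma adj_eval_power (w : adjoin power) g h i :
  g i = h i -> adj_eval w g i = adj_eval w h i.
Proof.
move=> gh; rewrite /adj_eval /adj_lift.
elim: (repr w) => //= l u ih; rewrite !powerME ih; congr (_ * _).
by case: l => [a|[]] //=; rewrite !powerVE gh.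
Qed.

End PowerGroup.

(** * Sequences in a finite group *)

Section CountablePower.
Variable F : finGroupType.
Implicit Types (p : power nat F) (x y u : F) (W : set (adjoin (power nat F))).

Definition delta (n : nat) x : power nat F := fun i => if i == n then x else 1.

Lemma delta_conj p n y : p * delta n y * p^-1 = delta n (p n * y * (p n)^-1).
Proof.
apply/funext => i; rewrite !powerME powerVE /delta.
by case: eqVneq => [->|_] //; rewrite mulg1 mulgV.
Qed.

Lemma card_power_nat x : x != 1 -> [set: power nat F] #= [set: set nat].
Proof.
move=> x1; rewrite card_eq_le; apply/andP; split.
  (* A sequence is recovered from its graph, coded as a set of naturals. *)
  apply/pcard_injP; exists (fun p => range (fun n => pickle (n, p n))).
  move=> p q _ _ pq; apply/funext => n.
  have : range (fun n => pickle (n, p n)) (pickle (n, p n)) by exists n.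
  by rewrite pq => -[m _ /(pcan_inj pickleK)[-> ->]].
have /injfunPex[f] : exists2 f : set nat -> power nat F,
    set_fun setT setT f & set_inj setT f; last exact: inj_card_le f.
exists (fun (S : set nat) n => if n \in S then x else 1) => //.
move=> S T _ _ ST; suff E n : (n \in S) = (n \in T).
  by apply/seteqP; split=> n /mem_set; [rewrite E|rewrite -E] => /set_mem.
have /eqP := congr1 (fun p : power nat F => p n) ST.
by case: (n \in S) (n \in T) => -[] //; rewrite ?(negPf x1) // eq_sym (negPf x1).
Qed.

(** The cylinders [C n] around [p] form a filter base, so finite intersections come for free and
    only sub-basic sets [co_zero w] need a cylinder. *)
Lemma nbhs_zariski_power W (p : zariski W) (V : set (zariski W)) :
  nbhs p V -> exists n, forall q : power nat F,
    (forall i, (i < n)%N -> q i = (p : power nat F) i) -> V q.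
Proof.
pose C n : set (power nat F) :=
  [set q | forall i, (i < n)%N -> q i = (p : power nat F) i].
have FC : Filter (filter_from setT C).
  apply: filter_from_filter; first by exists 0%N.
  move=> m n _ _; exists (maxn m n) => // q Cq; split=> i ltin; apply: Cq.
    by rewrite leq_max ltin.
  by rewrite leq_max ltin orbT.
rewrite nbhsE => -[O [[D sD <-] [Q DQ Qp]] OV].
suff [n _ CQ] : filter_from setT C Q.
  by exists n => q /CQ Qq; apply: OV; exists Q.
have [E sE QE] := sD _ DQ; rewrite -QE; apply: filter_bigI => K EK.
have /set_mem [w _ wK] := sE _ EK.
have : co_zero w p by rewrite wK; rewrite -QE in Qp; exact: Qp.
(* One nontrivial entry of w(p) suffices: it depends only on the entry of [p] at [i], which the
   cylinder [C i.+1] fixes. *)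
move=> /eqP wp1; have [i wpi] : exists i, adj_eval w p i <> 1.
  by apply/existsNP => wp; apply: wp1; exact/funext.
exists i.+1 => // q /(_ i (ltnSn i)) qi; rewrite -wK; apply/eqP => wq1.
by apply: wpi; rewrite -(adj_eval_power _ _ _ _ _ _ qi) wq1.
Qed.

Lemma infinite_pseudobase_power x W (p : zariski W) U :
  x != 1 -> pseudobase p U -> infinite_set U.
Proof.
move=> /eqP x1 [Up UE] /finite_fsetP[D UD].
have : nbhs p (\bigcap_(V in U) V).
  by rewrite UD; apply: filter_bigI => V DV; apply: Up; rewrite UD.
(* A finite pseudobase would make the singleton of [p] a neighborhood. Multiplying by [delta n x]
   alters [p] at entry [n] only, just past the entries fixed by the cylinder. *)
rewrite UE => /nbhs_zariski_power[n /(_ ((p : power nat F) * delta n x)) pn].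
have /(congr1 (fun q : power nat F => q n)) : (p : power nat F) * delta n x = p.
  apply: pn => i ltin; rewrite powerME /delta ltn_eqF // mulg1 //.
by rewrite powerME /delta eqxx -[RHS]mulg1 => /mulgI.
Qed.

Definition deltas (S : set F) : set (power nat F) :=
  [set delta n y | n in setT & y in S].

Lemma countable_deltas S : countable (deltas S).
Proof.
apply: sub_countable (countableP [set: nat * F]).
apply: card_le_trans (card_image_le (fun ny => delta ny.1 ny.2) _).
by apply: subset_card_le => _ [n _ [y _ <-]]; exists (n, y).
Qed.

(** At entry [n], an element [delta m z] of the second set reads [z] or 1, and neither lies in
    [S]. *)
Lemma deltas_disjoint (S : set F) :
  ~ S 1 -> deltas S `&` deltas (~` S) = set0.
Proof.
move=> S1; apply/seteqP; split=> // _ [[n _ [y Sy <-]] [m _ [z Sz zy]]].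
have := congr1 (fun p : power nat F => p n) zy; rewrite /delta eqxx.
by case: ifP => _ zy'; [apply: Sz|apply: S1]; rewrite zy'.
Qed.

Lemma bigcap_co_zero_deltas (S : set F) : ~ S 1 ->
    (forall u, (forall y, S y -> S (u * y * u^-1)) -> u = 1) ->
  [set 1] = \bigcap_(w in [set adj_conj _ a b | a in deltas S &
                                                b in deltas (~` S)]) co_zero w.
Proof.
move=> S1 SF; apply/seteqP; split=> [_ -> _ [a Sa [b Sb <-]]|p pS].
  apply/co_zero_conj; rewrite invg1 mulg1 mul1g => ab.
  have : (deltas S `&` deltas (~` S)) b by split=> //; rewrite -ab.
  by rewrite deltas_disjoint.
apply/funext => n; apply: SF => y Sy; apply: contrapT => Sny.
(* The forbidden value b is taken to be the conjugate of [delta n y] by [p] itself. *)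
have /co_zero_conj : co_zero (adj_conj _ (delta n y)
    (delta n (p n * y * (p n)^-1))) p.
  apply: pS; exists (delta n y); first by exists n => //; exists y.
  exists (delta n (p n * y * (p n)^-1)) => //.
  by exists n => //; exists (p n * y * (p n)^-1).
by apply; exact: delta_conj.
Qed.

End CountablePower.

(** * A rigid pair of generators of S_3 *)

Section SymmetricGroup3.

Let i0 : 'I_3 := @Ordinal 3 0 isT.
Let i1 : 'I_3 := @Ordinal 3 1 isT.
Let i2 : 'I_3 := @Ordinal 3 2 isT.
Let s : {perm 'I_3} := tperm i0 i1.
Let c : {perm 'I_3} := s * tperm i1 i2.

(** A transposition and a 3-cycle, not conjugate because their parities differ. *)
Definition S3_generators : set {perm 'I_3} := [set s; c].

Let odd_s : odd_perm s = true. Proof. by rewrite odd_tperm. Qed.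

Let odd_c : odd_perm c = false. Proof. by rewrite odd_permM !odd_tperm. Qed.

Let s2 : s i2 = i2. Proof. by rewrite tpermD. Qed.

Let c2 : c i2 = i1. Proof. by rewrite permM s2 tpermR. Qed.

Let c1 : c i1 = i0. Proof. by rewrite permM tpermR tpermD. Qed.

Lemma S3_generators_neq1 : ~ S3_generators 1.
Proof.
case=> e; first by move: odd_s; rewrite -e odd_perm1.
by move: c2; rewrite -e perm1.
Qed.

(** Conjugation preserves parity, so [u] commutes with both [s] and [c]. Commuting with [s], it
    fixes [i2], the only fixed point of [s]; commuting with [c], it fixes the whole orbit of [i2]
    under [c]. *)
Lemma S3_generators_conj_closed u :
  (forall y, S3_generators y -> S3_generators (u * y * u^-1)) -> u = 1.
Proof.
move=> Su.
have odd_conj y : odd_perm (u * y * u^-1) = odd_perm y.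
  by rewrite !odd_permM odd_permV addbC addbA addbb.
have comm y z : u * y * u^-1 = y -> u (y z) = y (u z).
  by move=> e; rewrite -!permM -{1}e mulgVK.
have us : u * s * u^-1 = s.
  have /Su[//|e] : S3_generators s by left.
  by move: (odd_conj s); rewrite e odd_s odd_c.
have uc : u * c * u^-1 = c.
  have /Su[e|//] : S3_generators c by right.
  by move: (odd_conj c); rewrite e odd_s odd_c.
have s_fix j : j = s j -> j = i2.
  rewrite /s; case: tpermP => [-> //|-> //|].
  by case: j => -[|[|[|//]]] lt3 j0 j1 _; [case: j0|case: j1|]; exact: val_inj.
have u2 : u i2 = i2 by apply: s_fix; rewrite -(comm s _ us) s2.
have u1 : u i1 = i1 by rewrite -c2 (comm c _ uc) u2.
have u0 : u i0 = i0 by rewrite -c1 (comm c _ uc) u1.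
apply/permP => -[[|[|[|//]]] lt3]; rewrite perm1.
- by rewrite (_ : Ordinal lt3 = i0) ?u0 //; exact: val_inj.
- by rewrite (_ : Ordinal lt3 = i1) ?u1 //; exact: val_inj.
- by rewrite (_ : Ordinal lt3 = i2) ?u2 //; exact: val_inj.
Qed.

End SymmetricGroup3.

Theorem theorem2 :
  exists G : groupType,
    [/\ [set: G] #= [set: set nat],
        pseudocharacter (zariski (@adj_le G 2)) [set: nat] &
        exists A B : set G,
          [/\ countable A, countable B, A `&` B = set0 &
              [set 1] =
              \bigcap_(w in [set adj_var * adj_const a * adj_var^-1 *
                                 adj_const b^-1 | a in A & b in B])
                 co_zero w]].
Proof.
(* Nontriviality of S_3 gives both the cardinality of the power and the absence of finite
   pseudobases. *)
have x1 : tperm ord0 ord_max != 1 :> {perm 'I_3}.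
  by apply/eqP => /(congr1 (@odd_perm _)); rewrite odd_tperm odd_perm1.
have AB1 := bigcap_co_zero_deltas _ _ S3_generators_neq1
              S3_generators_conj_closed.
exists (power nat {perm 'I_3}); split.
- exact: card_power_nat x1.
- pose p : zariski (@adj_le (power nat {perm 'I_3}) 2) :=
    (1 : power nat {perm 'I_3}).
  apply: (pseudocharacter_nat _ p).
    exact: countable_zariski_pseudobase (countable_deltas _ _)
      (countable_deltas _ _) AB1.
  by move=> U; exact: infinite_pseudobase_power x1.
- exists (deltas _ S3_generators), (deltas _ (~` S3_generators)).
  split; [exact: countable_deltas|exact: countable_deltas| |exact: AB1].
  exact: deltas_disjoint _ _ S3_generators_neq1.
Qed.
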